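(* For any two graphs $G$ and $H$, $f_{\text{opt}}(G\times H) \leq f_{\text{opt}}(G)\,f_{\text{opt}}(H)$.
   Context: Graphs are finite and connected. $G\times H$ denotes the Cartesian product: vertex set $V(G)\times V(H)$, with $(g_1,h_1)$ adjacent to $(g_2,h_2)$ iff either $g_1=g_2$ and $h_1h_2\in E(H)$, or $h_1=h_2$ and $g_1g_2\in E(G)$. A distribution of pebbles on a graph assigns a nonnegative integer number of pebbles to each vertex. A pebbling move removes two pebbles from a vertex and places one pebble on an adjacent vertex. A distribution is solvable if for every vertex $v$ there is a sequence (possibly empty) of pebbling moves after which $v$ has at least one pebble. The optimal pebbling number $f_{\text{opt}}(G)$ is the least number of pebbles in a solvable distribution on $G$. *)

(* Defs.v *)
From Stdlib Require Import Relations.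
From mathcomp Require Import all_boot boolp.

Set Implicit Arguments.
Unset Strict Implicit.
Unset Printing Implicit Defensive.

Record sgraph := SGraph {
  vertex :> finType;
  adj : rel vertex;
  adj_sym : symmetric adj;
  adj_irr : irreflexive adj }.

Definition connected (G : sgraph) : Prop :=
  forall x y : G, connect (@adj G) x y.

Section CartesianProduct.

Variables G H : sgraph.

Definition cart_adj : rel (G * H) := fun p q =>
  ((p.1 == q.1) && adj p.2 q.2) || ((p.2 == q.2) && adj p.1 q.1).

Lemma cart_adj_sym : symmetric cart_adj.
Proof.
move=> p q; rewrite /cart_adj (eq_sym p.1) (eq_sym p.2).
by rewrite (adj_sym p.1) (adj_sym p.2).
Qed.

Lemma cart_adj_irr : irreflexive cart_adj.
Proof. by move=> p; rewrite /cart_adj !adj_irr !andbF. Qed.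

Definition cart_prod : sgraph := SGraph cart_adj_sym cart_adj_irr.

End CartesianProduct.

Section Pebbling.

Variable G : sgraph.

Definition distribution := {ffun G -> nat}.

Definition npebbles (D : distribution) : nat := \sum_(v : G) D v.

(* The subtraction is never truncated, since u holds at least two pebbles. *)
Definition pebbling_move (D D' : distribution) : Prop :=
  exists u v : G, [/\ adj u v, 2 <= D u &
    D' = [ffun w => if w == u then D w - 2
                    else if w == v then D w + 1 else D w]].

Definition reachable : distribution -> distribution -> Prop :=
  clos_refl_trans distribution pebbling_move.

Definition solvable (D : distribution) : Prop :=
  forall v : G, exists2 D', reachable D D' & 1 <= D' v.

Lemma solvable_exists :
  exists n, `[< exists2 D, solvable D & npebbles D = n >].
Proof.
pose D : distribution := [ffun=> 1].
exists (npebbles D); apply/asboolP; exists D => // v.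
by exists D; [apply: rt_refl | rewrite ffunE].
Qed.

Definition fopt : nat := ex_minn solvable_exists.

End Pebbling.

(* Main.v *)
(** Distributions on [G] form the free commutative monoid on the single pebbles,
    and reachability is compatible with addition.  Let [D] and [E] be optimal
    distributions on [G] and [H], and put [D x * E y] pebbles on [(x, y)].  This
    product is biadditive, and a move [2 u -> v] on [G] becomes, after taking
    the product with [E], [E y] moves [2 (u, y) -> (v, y)] for every [y]; hence
    reachability in one factor carries over to products.  If [D] reaches [D']
    with a pebble on [x] and [E] reaches [E'] with a pebble on [y], then the
    product of [D] and [E] reaches that of [D'] and [E'], which has a pebble on
    [(x, y)]. *)

From HB Require Import structures.
Require Import Defs.
From Stdlib Require Import Relations.
From mathcomp Require Import all_boot boolp ssralg.

Set Implicit Arguments.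
Unset Strict Implicit.
Unset Printing Implicit Defensive.

Import GRing.Theory.

Lemma adj_neq (G : sgraph) (u v : G) : adj u v -> u != v.
Proof. by apply: contraTneq => ->; rewrite adj_irr. Qed.

Lemma homo_reachable (G K : sgraph) (f : distribution G -> distribution K) :
    {homo f : D D' / pebbling_move D D' >-> reachable D D'} ->
  {homo f : D D' / reachable D D'}.
Proof.
move=> f_move D D'; elim=> {D D'} [D D' /f_move //|D|D1 D2 D3 _ rf12 _ rf23].
  exact: rt_refl.
exact: rt_trans rf12 rf23.
Qed.

Section Distributions.

Variable G : sgraph.
Implicit Types (D E F : distribution G) (u v : G).

Local Open Scope ring_scope.

Definition pebble v : distribution G := [ffun w => (w == v)%:R].

Lemma sum_pebble D : D = \sum_v pebble v *+ D v.
Proof.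
apply/ffunP=> w; rewrite sum_ffunE (bigD1 w) //= big1 => [|v /negPf vw].
  by rewrite addr0 ffunMnE ffunE eqxx mulr1n natn.
by rewrite ffunMnE ffunE eq_sym vw mul0rn.
Qed.

Lemma move_pebblesE D E u v :
    u != v -> D = E + pebble u *+ 2 ->
  [ffun w => if w == u then D w - 2 else if w == v then D w + 1 else D w]%N =
  E + pebble v.
Proof.
move=> uv ->; apply/ffunP=> w; rewrite !(ffunE, ffunMnE) !natrE.
case: (w =P u) => [->|_]; first by rewrite (negPf uv) addnK addn0.
by case: (w =P v); rewrite !addn0.
Qed.

Lemma pebbling_moveP D D' :
  pebbling_move D D' <->
  exists u v E, [/\ adj u v, D = E + pebble u *+ 2 & D' = E + pebble v].
Proof.
split=> [[u [v [uv Du ->]]]|[u [v [E [uv defD ->]]]]]; exists u, v.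
  pose E : distribution G := [ffun w => D w - (pebble u *+ 2) w]%N.
  have defD : D = E + pebble u *+ 2.
    apply/ffunP=> w; rewrite [RHS]ffunE natrE ffunE subnK //.
    by rewrite ffunMnE ffunE; case: eqP => [->|_]; rewrite ?mul0rn.
  by exists E; rewrite -(move_pebblesE (adj_neq uv) defD).
split; rewrite ?(move_pebblesE _ defD) ?adj_neq // defD.
by rewrite ffunE ffunMnE ffunE eqxx natrE leq_addl.
Qed.

Lemma reachable_addr F : {homo +%R^~ F : D D' / reachable D D'}.
Proof.
apply: homo_reachable => D D' /pebbling_moveP[u [v [E [uv -> ->]]]].
apply/rt_step/pebbling_moveP; exists u, v, (E + F).
by rewrite ![E + F + _]addrAC.
Qed.

Lemma reachableD D D' E E' :
  reachable D D' -> reachable E E' -> reachable (D + E) (D' + E').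
Proof.
move=> rD rE; apply: rt_trans (reachable_addr E rD) _.
by rewrite ![D' + _]addrC; apply: reachable_addr.
Qed.

Lemma reachable_sum (I : Type) (r : seq I) (P : pred I)
    (D D' : I -> distribution G) :
    (forall i, P i -> reachable (D i) (D' i)) ->
  reachable (\sum_(i <- r | P i) D i) (\sum_(i <- r | P i) D' i).
Proof.
move=> rD; apply: big_rec2 => [|i E E' Pi rE]; first exact: rt_refl.
by apply: reachableD => //; apply: rD.
Qed.

Lemma reachableMn D D' n : reachable D D' -> reachable (D *+ n) (D' *+ n).
Proof.
move=> rD; elim: n => [|n IHn]; first exact: rt_refl.
by rewrite !mulrS; apply: reachableD.
Qed.

Lemma reachable_pebble u v : adj u v -> reachable (pebble u *+ 2) (pebble v).
Proof.
move=> uv; apply/rt_step/pebbling_moveP.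
by exists u, v, 0; rewrite !add0r.
Qed.

End Distributions.

Section AdditiveMaps.

Variables G K : sgraph.
Implicit Types phi psi : {additive distribution G -> distribution K}.

Local Open Scope ring_scope.

Lemma homo_reachable_additive phi :
    (forall u v, adj u v -> reachable (phi (pebble u *+ 2)) (phi (pebble v))) ->
  {homo phi : D D' / reachable D D'}.
Proof.
move=> phi_adj.
apply: homo_reachable => D D' /pebbling_moveP[u [v [E [uv -> ->]]]].
rewrite ![phi (E + _)]raddfD.
by apply: reachableD; [apply: rt_refl | apply: phi_adj].
Qed.

Lemma reachable_additive_pebble phi psi :
    (forall v, reachable (phi (pebble v)) (psi (pebble v))) ->
  forall D, reachable (phi D) (psi D).
Proof.
move=> phi_psi D; rewrite [D]sum_pebble !raddf_sum.
by apply: reachable_sum => v _; rewrite !raddfMn; apply: reachableMn.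
Qed.

End AdditiveMaps.

Section ProductDistribution.

Variables G H : sgraph.
Implicit Types (D : distribution G) (E : distribution H).

Local Open Scope ring_scope.

Definition prod_dist D E : distribution (cart_prod G H) :=
  [ffun p => D p.1 * E p.2].

Definition prod_distr E D := prod_dist D E.

Fact prod_dist_is_nmod_morphism D : nmod_morphism (prod_dist D).
Proof.
by split=> [|E E']; apply/ffunP=> p; rewrite !ffunE ?mulr0 ?mulrDr.
Qed.

Fact prod_distr_is_nmod_morphism E : nmod_morphism (prod_distr E).
Proof.
by split=> [|D D']; apply/ffunP=> p; rewrite !ffunE ?mul0r ?mulrDl.
Qed.

HB.instance Definition _ D :=
  GRing.isNmodMorphism.Build _ _ (prod_dist D) (prod_dist_is_nmod_morphism D).

HB.instance Definition _ E :=
  GRing.isNmodMorphism.Build _ _ (prod_distr E) (prod_distr_is_nmod_morphism E).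

Lemma prod_distMnl D E n : prod_dist (D *+ n) E = prod_dist D E *+ n.
Proof. exact: (raddfMn (prod_distr E)). Qed.

Lemma prod_distMnr D E n : prod_dist D (E *+ n) = prod_dist D E *+ n.
Proof. exact: raddfMn. Qed.

Lemma prod_dist_pebble (x : G) (y : H) :
  prod_dist (pebble x) (pebble y) = @pebble (cart_prod G H) (x, y).
Proof. by apply/ffunP=> p; rewrite !ffunE -natrM mulnb. Qed.

Lemma npebbles_prod_dist D E :
  npebbles (prod_dist D E) = (npebbles D * npebbles E)%N.
Proof.
rewrite /npebbles big_distrlr pair_bigA.
by apply: eq_bigr => p _; rewrite ffunE.
Qed.

Lemma reachable_prodl E : {homo prod_distr E : D D' / reachable D D'}.
Proof.
apply: homo_reachable_additive => u v uv.
apply: (@reachable_additive_pebble _ _ (prod_dist _) (prod_dist _)) => y.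
rewrite /= prod_distMnl !prod_dist_pebble.
by apply: reachable_pebble; rewrite /= /cart_adj /= eqxx uv orbT.
Qed.

Lemma reachable_prodr D : {homo prod_dist D : E E' / reachable E E'}.
Proof.
apply: homo_reachable_additive => u v uv.
apply: (@reachable_additive_pebble _ _ (prod_distr _) (prod_distr _)) => x.
rewrite /= /prod_distr prod_distMnr !prod_dist_pebble.
by apply: reachable_pebble; rewrite /= /cart_adj /= eqxx uv.
Qed.

Lemma solvable_prod_dist D E :
  solvable D -> solvable E -> solvable (prod_dist D E).
Proof.
move=> solD solE [x y].
have [D' rD D'x] := solD x; have [E' rE E'y] := solE y.
exists (prod_dist D' E'); last by rewrite ffunE muln_gt0 D'x.
exact: rt_trans (reachable_prodl E rD) (reachable_prodr D' rE).
Qed.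

End ProductDistribution.

Lemma fopt_attained (G : sgraph) :
  exists2 D : distribution G, solvable D & npebbles D = fopt G.
Proof. by rewrite /fopt; case: ex_minnP => n /asboolP. Qed.

Lemma fopt_le (G : sgraph) (D : distribution G) :
  solvable D -> fopt G <= npebbles D.
Proof.
rewrite /fopt; case: ex_minnP => n _ min_n solD.
by apply: min_n; apply/asboolP; exists D.
Qed.

Theorem theorem3 (G H : sgraph) (connG : connected G) (connH : connected H) :
  fopt (cart_prod G H) <= fopt G * fopt H.
Proof.
have [D solD <-] := fopt_attained G; have [E solE <-] := fopt_attained H.
by rewrite -npebbles_prod_dist; apply/fopt_le/solvable_prod_dist.
Qed.
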